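(* Let $\theta=(\alpha,s)$ with $\alpha_1,\dots,\alpha_n>0$ and $s_1,\dots,s_n\in\mathbb{R}_+^d\setminus\{0\}$, and let $\mathbb{P}_\theta$ be the law $\mathcal{G}_{d,n}(\alpha,s)$, with Stein operator $\mathcal{T}_\theta$. Let $\mathcal{F}$ be a linear space of test functions $f:\mathbb{R}^d\to\mathbb{R}^d$ and $\mathcal{H}_K$ the vector-valued RKHS of a matrix-valued kernel $K:\mathbb{R}^d\times\mathbb{R}^d\to\mathbb{R}^{d\times d}$. Assume: (D1) $\mathcal{T}_\theta$ is a Stein operator for $\mathbb{P}_\theta$ on $\mathcal{F}$, i.e. $\mathbb{E}_{X\sim\mathbb{P}_\theta}[(\mathcal{T}_\theta f)(X)]=0$ for every $f\in\mathcal{F}$; (D3) the Stein identity characterises $\mathbb{P}_\theta$ on $\mathcal{F}$: for every probability measure $\mathbb{Q}$ on $\mathbb{R}^d$, if $\mathbb{E}_{X\sim\mathbb{Q}}[(\mathcal{T}_\theta f)(X)]=0$ for all $f\in\mathcal{F}$, then $\mathbb{Q}=\mathbb{P}_\theta$. Then, for every probability measure $\mathbb{Q}$ on $\mathbb{R}^d$ such that (D2) $\mathcal{H}_K\subseteq\mathcal{F}$, the linear functional $f\mapsto\mathbb{E}_{X\sim\mathbb{Q}}[(\mathcal{T}_\theta f)(X)]$ is well defined on $\mathcal{F}$ and continuous on $\mathcal{H}_K$, and $\mathcal{H}_K$ is dense in $\mathcal{F}$ for a topology on $\mathcal{F}$ for which this functional is continuous, one has $$\mathrm{KSD}_{\m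athcal{T}}(\mathbb{Q}\,\|\,\mathbb{P}_\theta)=0\quad\Longleftrightarrow\quad\mathbb{Q}=\mathbb{P}_\theta.$$
   Context: $d,n\ge 1$ are integers, $\mathbb{R}_+=[0,\infty)$, $\langle\cdot,\cdot\rangle$ is the Euclidean scalar product. $\mathcal{G}_{d,n}(\alpha,s)$ is the law on $\mathbb{R}_+^d$ with characteristic function $t\mapsto\prod_{j=1}^n(1-\mathrm{i}\langle s_j,t\rangle)^{-\alpha_j}$, i.e. the multivariate generalized gamma convolution with Thorin measure $\nu_\theta=\sum_{j=1}^n\alpha_j\delta_{s_j}$. Its Stein operator is $$(\mathcal{T}_\theta f)(x)=\langle x,f(x)\rangle-\sum_{j=1}^n\alpha_j\,\mathbb{E}\bigl[\langle s_j,f(x+s_jE)\rangle\bigr],\qquad E\sim\mathrm{Exp}(1).$$ A matrix-valued kernel is a function $K$ with $K(x,y)=K(y,x)^\top$ and $\sum_{i,j}v_i^\top K(x_i,x_j)v_j\ge 0$ for all finite families $x_i\in\mathbb{R}^d$, $v_i\in\mathbb{R}^d$. $\mathcal{H}_K$ is the unique Hilbert space of functions $f:\mathbb{R}^d\to\mathbb{R}^d$ containing all $K(\cdot,x)v$ and satisfying $\langle f(x),v\rangle=\langle f,K(\cdot,x)v\rangle_{\mathcal{H}_K}$. The Kernel Stein Discrepancy is $$\mathrm{KSD}_{\mathcal{T}}(\mathbb{Q}\,\|\,\mathbb{P}_\theta)=\sup_{f\in\mathcal{H}_K,\ \|f\|_{\mathcal{H}_K}\le 1}\bigl|\mathbb{E}_{Y\sim\mathbb{Q}}[(\mathcal{T}_\theta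 f)(Y)]\bigr|.$$ The intended topology on $\mathcal{F}$ in (D2) is typically that of the weighted supremum norm $\|f\|_{\mathcal{F}}=\sup_x\|f(x)\|/(1+\|x\|)$. *)

(* Defs.v *)
From HB Require Import structures.
From mathcomp Require Import all_boot all_order all_algebra.
From mathcomp Require Import complex.
From mathcomp Require Import all_classical all_reals all_analysis.

Set Implicit Arguments.
Unset Strict Implicit.
Unset Printing Implicit Defensive.

Import Order.TTheory GRing.Theory Num.Theory.
Import numFieldNormedType.Exports.

Local Open Scope classical_set_scope.
Local Open Scope ring_scope.

(* R^d with its Borel sigma-algebra; as a type it is convertible to 'cV[R]_d. *)
Notation borel_cV R d := (g_sigma_algebraType (@open 'cV[R]_d)).

(* A measure is here a function on all subsets, whose values on non-measurable
   sets are irrelevant; equality of laws only concerns the measurable ones. *)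
Definition same_law (R : realType) (disp : measure_display)
    (T : measurableType disp) (P Q : probability T R) : Prop :=
  forall A : set T, measurable A -> P A = Q A.

Definition dotv (R : realType) (d : nat) (x y : 'cV[R]_d) : R :=
  \sum_(i < d) x i 0 * y i 0.

Section ComplexPower.
Variable R : realType.
Local Open Scope complex_scope.

Definition cexp (z : R[i]) : R[i] :=
  (expR (complex.Re z) * cos (complex.Im z)) +i*
  (expR (complex.Re z) * sin (complex.Im z)).

(* The principal argument, in ]-pi, pi], of a nonzero z. *)
Definition carg (z : R[i]) : R :=
  let a := acos (complex.Re z / ComplexField.Normc.normc z) in
  if 0 <= complex.Im z then a else - a.

Definition cln (z : R[i]) : R[i] := ln (ComplexField.Normc.normc z) +i* carg z.

(* The principal branch of z ^ a, for z nonzero and a real exponent a. *)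
Definition cpowr (z : R[i]) (a : R) : R[i] := cexp (a%:C * cln z).

Definition cexpectation (disp : measure_display) (T : measurableType disp)
    (P : probability T R) (X : T -> R[i]) : R[i] :=
  fine 'E_P[fun w => complex.Re (X w)] +i* fine 'E_P[fun w => complex.Im (X w)].

Definition char_fun (d : nat) (P : probability (borel_cV R d) R)
    (t : 'cV[R]_d) : R[i] :=
  cexpectation P (fun x => cexp (0 +i* dotv t x)).

Definition is_ggc_law (d n : nat) (alpha : 'I_n -> R) (s : 'I_n -> 'cV[R]_d)
    (P : probability (borel_cV R d) R) : Prop :=
  P [set x : 'cV[R]_d | forall i, 0 <= x i 0] = 1%E /\
  forall t : 'cV[R]_d,
    char_fun P t = \prod_(j < n) cpowr (1 -i* dotv (s j) t) (- alpha j).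

End ComplexPower.

Definition exp1 (R : realType) : probability (measurableTypeR R) R :=
  exponential_distribution_exponential_prob__canonical__probability_measure_Probability
    (@ltr01 R).

Section SteinOperator.
Variables (R : realType) (d n : nat).
Variables (alpha : 'I_n -> R) (s : 'I_n -> 'cV[R]_d).
Implicit Types f : 'cV[R]_d -> 'cV[R]_d.

Definition stein_op f (x : 'cV[R]_d) : R :=
  dotv x (f x) -
  \sum_(j < n) alpha j * fine 'E_(exp1 R)[fun e : R => dotv (s j) (f (x + e *: s j))].

(* The expectations that occur in [stein_op f x] exist, for every x. *)
Definition stein_op_defined f : Prop :=
  forall (x : 'cV[R]_d) (j : 'I_n),
    (exp1 R).-integrable setT
      (fun e : R => (dotv (s j) (f (x + e *: s j)))%:E).

Variable Q : probability (borel_cV R d) R.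

Definition stein_integrable f : Prop :=
  Q.-integrable setT (fun x => (stein_op f x)%:E).

Definition stein_mean f : R := fine 'E_Q[stein_op f].

End SteinOperator.

Section Kernel.
Variables (R : realType) (d : nat).
Local Notation V := 'cV[R]_d.

Definition is_matrix_kernel (K : V -> V -> 'M[R]_d) : Prop :=
  (forall x y, K x y = (K y x)^T) /\
  forall (m : nat) (x v : 'I_m -> V),
    0 <= \sum_(i < m) \sum_(j < m) dotv (v i) (K (x i) (x j) *m v j).

(* A Hilbert space of functions V -> V is rendered as an abstract Hilbert space
   together with an injective linear map [rkhs_fun] into V -> V, the function
   space itself being the range of that map. *)
Record rkhs (K : V -> V -> 'M[R]_d) := Rkhs {
  rkhs_space :> completeNormedModType R ;
  rkhs_dot : {dot rkhs_space for idfun} ;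
  rkhs_normE : forall h : rkhs_space, `|h| ^+ 2 = rkhs_dot h h ;
  rkhs_fun : {linear rkhs_space -> (V -> V)} ;
  rkhs_fun_inj : injective rkhs_fun ;
  rkhs_kernel : forall x v : V, exists2 k : rkhs_space,
    rkhs_fun k = (fun y => K y x *m v) &
    forall h : rkhs_space, dotv (rkhs_fun h x) v = rkhs_dot h k }.

End Kernel.

Section KSD.
Variables (R : realType) (d n : nat).
Variables (alpha : 'I_n -> R) (s : 'I_n -> 'cV[R]_d).
Local Notation V := 'cV[R]_d.
Variables (K : V -> V -> 'M[R]_d) (H : rkhs K).
Implicit Types (F : set (V -> V)) (P Q : probability (borel_cV R d) R).

Definition ksd Q : \bar R :=
  ereal_sup [set `| 'E_Q[stein_op alpha s (rkhs_fun H h)] |%E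
            | h in [set h : H | `|h| <= 1]].

(* The mean of a non-integrable function is a junk value, so "E = 0" includes
   integrability. *)
Definition stein_identity Q F : Prop :=
  forall f, F f -> stein_integrable alpha s Q f /\ stein_mean alpha s Q f = 0.

Definition stein_operator_for P F : Prop :=
  (forall f, F f -> stein_op_defined s f) /\ stein_identity P F.

Definition stein_characterises P F : Prop :=
  forall Q, stein_identity Q F -> same_law Q P.

(* The topology on F is that of a topological space T in bijection with F
   through j. *)
Definition stein_dense Q F : Prop :=
  [/\ range (rkhs_fun H) `<=` F,
      (forall f, F f -> stein_integrable alpha s Q f),
      continuous (fun h : H => stein_mean alpha s Q (rkhs_fun H h)) &
      exists (T : topologicalType) (j : T -> (V -> V)),
        [/\ set_bij [set: T] F j,
            dense (j @^-1` range (rkhs_fun H)) &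
            continuous (fun t : T => stein_mean alpha s Q (j t))]].

End KSD.

(* Main.v *)
Require Import Defs.
From mathcomp Require Import all_boot all_order all_algebra.
From mathcomp Require Import all_classical all_reals all_analysis.

Set Implicit Arguments.
Unset Strict Implicit.
Unset Printing Implicit Defensive.

Import Order.TTheory GRing.Theory Num.Theory.
Import numFieldNormedType.Exports.

Local Open Scope classical_set_scope.
Local Open Scope ring_scope.

(** The discrepancy is the norm of the linear functional
    [h |-> E_Q[T h]] on the unit ball of the kernel space [H], so it vanishes
    exactly when the functional vanishes on all of [H]: a vector of arbitrary
    norm is a multiple of a vector of the unit ball, and the functional is
    homogeneous ([stein_mean_scale], [ksd_eq0P]).

    If it vanishes on [H], it vanishes on the whole test class [F], because [H]
    is dense in [F] for a topology that makes the functional continuous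
    ([continuous_dense_eq0]); the Stein identity for [Q] on [F] then forces
    [Q] to be [P].  Conversely the means of a function under two measures that
    agree on measurable sets coincide ([same_law_expectation]), so a [Q] with
    the law of [P] inherits the Stein identity of [P], in particular
    on [H]. *)

(** The locus where the function does not vanish is open, hence would meet the
    dense set if it were nonempty. *)
Lemma continuous_dense_eq0 (R : realType) (T : topologicalType) (A : set T)
    (g : T -> R) :
  dense A -> continuous g -> (forall t, A t -> g t = 0) -> forall t, g t = 0.
Proof.
move=> dA cg gA t; apply: contrapT => gt0.
have oN0 : open (g @^-1` (~` [set 0])).
  by apply: open_comp => [u _|]; [exact: cg|exact/closed_openC/closed_eq].
by have [|u [gu0 /gA]] := dA _ _ oN0; first by exists t.
Qed.

Lemma same_law_expectation (R : realType) (disp : measure_display)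
    (T : measurableType disp) (P Q : probability T R) (X : T -> R) :
  same_law Q P -> ('E_Q[X] = 'E_P[X])%E.
Proof.
move=> QP; rewrite !unlock; apply: eq_measure_integral => A mA _.
exact: QP.
Qed.

Section SteinScaling.
Variables (R : realType) (d n : nat).
Variables (alpha : 'I_n -> R) (s : 'I_n -> 'cV[R]_d).
Implicit Types f : 'cV[R]_d -> 'cV[R]_d.

Lemma dotvZr (c : R) (x y : 'cV[R]_d) : dotv x (c *: y) = c * dotv x y.
Proof.
by rewrite /dotv mulr_sumr; apply: eq_bigr => i _; rewrite mxE mulrCA.
Qed.

Lemma fine_expectationZ (disp : measure_display) (T : measurableType disp)
    (P : probability T R) (X : T -> R) (c : R) :
  P.-integrable setT (EFin \o X) ->
  fine 'E_P[fun w => c * X w] = c * fine 'E_P[X].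
Proof.
move=> iX; rewrite !unlock.
under eq_integral do rewrite EFinM.
by rewrite integralZl// fineM// integrable_fin_num.
Qed.

Lemma stein_op_scale f (c : R) (x : 'cV[R]_d) : stein_op_defined s f ->
  stein_op alpha s (c *: f) x = c * stein_op alpha s f x.
Proof.
move=> df; rewrite /stein_op dotvZr mulrBr; congr (_ - _).
rewrite mulr_sumr; apply: eq_bigr => j _; rewrite mulrCA; congr (_ * _).
rewrite -fine_expectationZ; last exact: df.
by congr (fine (expectation _ _)); apply/funext => e; rewrite -dotvZr.
Qed.

Lemma stein_mean_scale (Q : probability (borel_cV R d) R) f (c : R) :
  stein_op_defined s f -> stein_integrable alpha s Q f ->
  stein_mean alpha s Q (c *: f) = c * stein_mean alpha s Q f.
Proof.
move=> df iQf; rewrite /stein_mean -fine_expectationZ//.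
by congr (fine (expectation _ _)); apply/funext => x; rewrite stein_op_scale.
Qed.

End SteinScaling.

Section Discrepancy.
Variables (R : realType) (d n : nat).
Variables (alpha : 'I_n -> R) (s : 'I_n -> 'cV[R]_d).
Variables (K : 'cV[R]_d -> 'cV[R]_d -> 'M[R]_d) (H : rkhs K).
Variable Q : probability (borel_cV R d) R.
Hypothesis opH : forall h : H, stein_op_defined s (rkhs_fun H h).
Hypothesis intH : forall h : H, stein_integrable alpha s Q (rkhs_fun H h).

Let stein_meanK (h : H) :
  ('E_Q[stein_op alpha s (rkhs_fun H h)] =
   (stein_mean alpha s Q (rkhs_fun H h))%:E)%E.
Proof.
by rewrite /stein_mean fineK// unlock integrable_fin_num//; exact: intH.
Qed.

(** A supremum of absolute values is zero exactly when each of them is, and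
    homogeneity carries this from the unit ball to all of [H].  Integrability
    makes the extended expectations in the supremum finite, so that they can
    be exchanged with the real [stein_mean]. *)
Lemma ksd_eq0P :
  ksd alpha s H Q = 0%E <->
  forall h : H, stein_mean alpha s Q (rkhs_fun H h) = 0.
Proof.
split=> [ksd0 h|mean0].
- have ball0 (k : H) : `|k| <= 1 -> stein_mean alpha s Q (rkhs_fun H k) = 0.
    move=> k1; apply/normr0_eq0/le_anti; rewrite normr_ge0 andbT.
    rewrite -lee_fin -abse_EFin -stein_meanK -[leRHS]ksd0.
    by apply: ereal_sup_ubound; exists k.
  have [->|h0] := eqVneq h 0; first by apply: ball0; rewrite normr0.
  have := ball0 (`|h|^-1 *: h).
  rewrite normrZ normfV normr_id mulVf ?normr_eq0// => /(_ (lexx _)).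
  rewrite linearZ stein_mean_scale// => /eqP.
  by rewrite mulf_eq0 invr_eq0 normr_eq0 (negbTE h0) => /eqP.
- rewrite /ksd (_ : [set _ | _ in _] = [set 0%E]) ?ereal_sup1//.
  apply/seteqP; split=> [_ [h _ <-]|_ ->] /=.
    by rewrite stein_meanK mean0 abse0.
  by exists 0; rewrite /= ?normr0// stein_meanK mean0 abse0.
Qed.

End Discrepancy.

Theorem proposition5p3 (R : realType) (d n : nat) (hd : (1 <= d)%N)
    (hn : (1 <= n)%N) (alpha : 'I_n -> R) (s : 'I_n -> 'cV[R]_d)
    (halpha : forall j, 0 < alpha j)
    (hs : forall j, (forall i, 0 <= s j i 0) /\ s j != 0)
    (P : probability (borel_cV R d) R) (hP : is_ggc_law alpha s P)
    (F : set ('cV[R]_d -> 'cV[R]_d)) (hF : submod_closed (mem F))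
    (K : 'cV[R]_d -> 'cV[R]_d -> 'M[R]_d) (hK : is_matrix_kernel K)
    (H : rkhs K)
    (D1 : stein_operator_for alpha s P F)
    (D3 : stein_characterises alpha s P F)
    (Q : probability (borel_cV R d) R)
    (D2 : stein_dense alpha s H Q F) :
  ksd alpha s H Q = 0%E <-> same_law Q P.
Proof.
have [opF steinP] := D1.
have [HF intQ _ [T [j [[jF _ jsurj] jdense jcont]]]] := D2.
have inF (h : H) : F (rkhs_fun H h) by apply: HF; exists h.
rewrite ksd_eq0P; [|by move=> h; exact/opF|by move=> h; exact/intQ].
split=> [mean0|QP h].
- apply: D3 => f Ff; split; first exact: intQ.
  have [t _ <-] := jsurj _ Ff.
  apply: (continuous_dense_eq0 jdense jcont) => u [h _ <-].
  exact: mean0.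
- have [_ <-] := steinP _ (inF h).
  by rewrite /stein_mean (same_law_expectation _ QP).
Qed.
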